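(* Fix $K\ge2$. Let $\pi$ be any uniformly fast blockwise-fair policy on the template family. Then for every instance $\nu$ of the template family and every arm $i\ne1$ with $\Delta_i>0$, $$\liminf_{R\to\infty}\frac{\mathbb E_\nu[N_i^{\mathrm{res}}]}{\log R}\ \ge\ \frac1{\mathrm{kl}(\mu_i,\mu_\star)},$$ and consequently $$\liminf_{R\to\infty}\frac{\mathrm{Reg}_{\mathbf m}(T)}{\log R}\ \ge\ \sum_{i\ne1:\,\Delta_i>0}\frac{\Delta_i}{\mathrm{kl}(\mu_i,\mu_\star)}.$$
   Context: Template family. For a residual budget $R$ and mandatory budget $M=M(R)$, the block structure has two blocks: block one has length $M$ and floor vector $(M,0,\dots,0)$ (arm $1$ must be pulled in every round of it); block two has length $R$ and zero floors; the horizon is $T=M+R$. The instances $\nu$ of the family are $K$-armed bandits with independent Bernoulli rewards with means $\mu_1,\dots,\mu_K\in(0,1)$ where $\mu_1=1/2$; $\mu_\star=\max_i\mu_i<1$, $\Delta_i=\mu_\star-\mu_i$. $\mathrm{kl}(p,q)=p\log\frac pq+(1-p)\log\frac{1-p}{1-q}$. A policy (one for each $R$) is blockwise fair if it meets all block floors. $N_i^{\mathrm{res}}$ is the number of pulls of arm $i$ in the residual (nonmandatory) rounds, i.e. in block two. The expected blockwise fair regret is $\mathrm{Reg}_{\mathbf m}(T)=\bigl(T\mu_\star-M\Delta_1\bigr)-\mathbb E[\sum_{t=1}^T\mu_{A_t}]$ with $A_t$ the arm pulled at round $t$. A blockwise-fair policy is uniformly fast on the template family if its expected fair regret is $o(R^a)$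 for every $a\in(0,1]$ on every instance of the family, as $R\to\infty$ with $M=M(R)$ growing at most polynomially in $R$. *)

(* Defs.v *)
From HB Require Import structures.
From mathcomp Require Export all_boot all_order all_algebra.
From mathcomp Require Export all_classical all_reals all_analysis.
Export Order.TTheory GRing.Theory Num.Theory numFieldNormedType.Exports.

Set Implicit Arguments.
Unset Strict Implicit.
Unset Printing Implicit Defensive.

Local Open Scope classical_set_scope.
Local Open Scope ring_scope.

(* The arms are 'I_K, so arm number 1 of the usual numbering has value 0. *)
Definition arm1 (K : nat) (hK : (1 < K)%N) : 'I_K := Ordinal (ltnW hK).

(* A history is the sequence of (pulled arm, observed Bernoulli reward),
   oldest round first. *)
Definition history (K : nat) : Type := seq ('I_K * bool).

Definition pulls (K : nat) (i : 'I_K) (h : history K) : nat :=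
  count (fun s => s.1 == i) h.

Record block (K : nat) := Block {
  block_len : nat;
  block_floor : 'I_K -> nat }.

(* The blocks are consecutive, the first one starting at the first round. *)
Fixpoint meets_floors (K : nat) (bs : seq (block K)) (h : history K) : bool :=
  if bs is b :: bs' then
    [forall i, (block_floor b i <= pulls i (take (block_len b) h))%N]
      && meets_floors bs' (drop (block_len b) h)
  else true.

(* m is the mandatory budget and r the residual budget. *)
Definition template (K : nat) (hK : (1 < K)%N) (m r : nat) : seq (block K) :=
  [:: Block m (fun i => if i == arm1 hK then m else 0%N);
      Block r (fun=> 0%N)].

Definition poly_growth (m : nat -> nat) : Prop :=
  exists c d : nat, \forall r \near \oo, (m r <= c * r ^ d)%N.

(* A possibly randomized policy: the conditional law of the next arm given the
   past. *)
Record policy (R : realType) (K : nat) := Policy {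
  action_prob : history K -> 'I_K -> R;
  action_prob_ge0 : forall h i, 0 <= action_prob h i;
  action_prob_sum1 : forall h, \sum_(i < K) action_prob h i = 1 }.

Section bandit.
Context {R : realType} {K : nat}.
Implicit Types (mu : 'I_K -> R) (p : policy R K).

Definition traj_prob mu p (T : nat) (h : T.-tuple ('I_K * bool)) : R :=
  \prod_(t < T) (action_prob p (take t h) (tnth h t).1 *
                 bernoulli_pmf (mu (tnth h t).1) (tnth h t).2).

Definition expect mu p (T : nat) (X : history K -> R) : R :=
  \sum_(h : T.-tuple ('I_K * bool)) traj_prob mu p h * X h.

Variable hK : (1 < K)%N.

Definition is_instance mu : Prop :=
  (forall i, 0 < mu i < 1) /\ mu (arm1 hK) = 2^-1.

(* The neutral element of the iterated maximum is itself one of the means, so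
   this is the maximum of the means. *)
Definition mu_star mu : R := \big[Num.max/mu (arm1 hK)]_(i < K) mu i.

Definition gap mu (i : 'I_K) : R := mu_star mu - mu i.

(* Floors are met almost surely, under every instance. *)
Definition blockwise_fair p (m r : nat) : Prop :=
  forall mu, is_instance mu ->
  forall h : (m + r).-tuple ('I_K * bool),
    0 < traj_prob mu p h -> meets_floors (template hK m r) h.

Definition expected_residual_pulls mu p (m r : nat) (i : 'I_K) : R :=
  expect mu p (m + r) (fun h => (pulls i (drop m h))%:R).

Definition fair_regret mu p (m r : nat) : R :=
  ((m + r)%:R * mu_star mu - m%:R * gap mu (arm1 hK))
  - expect mu p (m + r) (fun h => \sum_(s <- h) mu s.1).

(* One policy p r and one mandatory budget m r for each residual budget r; the
   growth condition on m is kept apart, as poly_growth. *)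
Definition uniformly_fast (m : nat -> nat) (p : nat -> policy R K) : Prop :=
  forall mu, is_instance mu -> forall a : R, 0 < a <= 1 ->
    (fun r => fair_regret mu (p r) (m r) r : R^o)
      =o_\oo (fun r => r%:R `^ a : R^o).

End bandit.

Definition kl (R : realType) (p q : R) : R :=
  p * ln (p / q) + (1 - p) * ln ((1 - p) / (1 - q)).

(* Main.v *)
Require Import Defs.
From mathcomp Require Import ring lra.

(* Following Lai and Robbins: fix a suboptimal arm i <> 1, and raise its mean to
   some l in (mu_star, 1), which keeps the instance in the template family and
   makes i its only optimal arm. Fairness spends block one on arm 1, so the fair
   regret is the sum of gap_j E[N_j^res]. Being uniformly fast, the policy has
   E[N_i^res] = o(r) under mu, but r - E'[N_i^res] = o(r^a) under the raised
   instance. The divergence between the two laws of the trajectory equals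
   kl(mu_i, l) E[N_i^res], and telling the instances apart this well costs at
   least about (1 - a) log r. Let a tend to 0 and l to mu_star. *)

Set Implicit Arguments.
Unset Strict Implicit.
Unset Printing Implicit Defensive.
Local Open Scope ring_scope.

(** Convexity of exp, from [1 + y <= expR y] alone: the tangent at [c * x], read at the endpoints 0
    and [c], gives [e1] and [e2]; weighting them by [1 - x] and [x] cancels the linear terms. *)
Lemma expR_chord (R : realType) (c x : R) :
  0 <= x <= 1 -> expR (c * x) <= 1 + x * (expR c - 1).
Proof.
move=> /andP[x0 x1].
have e1 : expR (c * x) * (1 - c * x) <= 1.
  have := expR_ge1Dx (- (c * x)).
  by rewrite -(ler_pM2l (expR_gt0 (c * x))) -expRD subrr expR0.
have e2 : expR (c * x) * (1 + c * (1 - x)) <= expR c.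
  have := expR_ge1Dx (c * (1 - x)).
  rewrite -(ler_pM2l (expR_gt0 (c * x))) -expRD.
  by rewrite (_ : c * x + _ = c); last ring.
have : (1 - x) * (expR (c * x) * (1 - c * x)) <= (1 - x) * 1.
  by apply: ler_wpM2l; rewrite ?subr_ge0.
have := ler_wpM2l x0 e2.
lra.
Qed.

(** * Expectations over trajectories and Wald's identity *)

Section trajectories.
Context {R : realType} {K : nat}.
Implicit Types (mu : 'I_K -> R) (p : policy R K) (s : 'I_K * bool).
Implicit Types (X Y : history K -> R).

(** The continuation of [p] once the first round is known to be [s]; it lets inductions on the
    horizon peel off the oldest round. *)
Definition policy_after p s : policy R K :=
  Policy (fun h => action_prob_ge0 p (s :: h))
         (fun h => action_prob_sum1 p (s :: h)).

Lemma traj_prob_cons mu p T s (h : T.-tuple ('I_K * bool)) :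
  traj_prob mu p [tuple of s :: h] =
  action_prob p [::] s.1 * bernoulli_pmf (mu s.1) s.2 *
  traj_prob mu (policy_after p s) h.
Proof.
rewrite /traj_prob big_ord_recl /= tnth0; congr (_ * _).
by apply: eq_bigr => t _; rewrite tnthS.
Qed.

Lemma expect0 mu p X : expect mu p 0 X = X [::].
Proof.
rewrite /expect (bigD1 [tuple]) //= big1 ?addr0 => [|h /negP[]].
  by rewrite /traj_prob big_ord0 mul1r.
by rewrite tuple0.
Qed.

Lemma expectS mu p T X :
  expect mu p T.+1 X =
  \sum_s action_prob p [::] s.1 * bernoulli_pmf (mu s.1) s.2 *
         expect mu (policy_after p s) T (fun h => X (s :: h)).
Proof.
rewrite /expect.
under [RHS]eq_bigr do rewrite mulr_sumr.
rewrite pair_big /=.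
rewrite (reindex (fun sh : ('I_K * bool) * T.-tuple ('I_K * bool) =>
                    [tuple of sh.1 :: sh.2])) /=.
  by apply: eq_bigr => -[s h] _; rewrite traj_prob_cons mulrA.
exists (fun h => (thead h, [tuple of behead h])) => [[s h] _|h _] /=.
  by rewrite theadE; congr pair; exact: val_inj.
by rewrite -tuple_eta.
Qed.

(** Null trajectories are exempted because fairness constrains only trajectories of positive
    probability. *)
Lemma eq_expect mu p T X Y :
  (forall h : T.-tuple ('I_K * bool), traj_prob mu p h != 0 -> X h = Y h) ->
  expect mu p T X = expect mu p T Y.
Proof.
move=> XY; apply: eq_bigr => h _.
by have [->|/XY->] := eqVneq (traj_prob mu p h) 0; rewrite ?mul0r.
Qed.

Lemma expectD mu p T X Y :
  expect mu p T (fun h => X h + Y h) = expect mu p T X + expect mu p T Y.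
Proof. by rewrite /expect -big_split; apply: eq_bigr => h _; rewrite mulrDr. Qed.

Lemma expectZ mu p T c X :
  expect mu p T (fun h => c * X h) = c * expect mu p T X.
Proof. by rewrite /expect mulr_sumr; apply: eq_bigr => h _; rewrite mulrCA. Qed.

Lemma expect_sum mu p T (I : Type) (r : seq I) (P : pred I)
    (X : I -> history K -> R) :
  expect mu p T (fun h => \sum_(i <- r | P i) X i h) =
  \sum_(i <- r | P i) expect mu p T (X i).
Proof.
by rewrite /expect exchange_big; apply: eq_bigr => h _; rewrite mulr_sumr.
Qed.

Lemma sum_first_round mu p (X : 'I_K -> R) :
  \sum_s action_prob p [::] s.1 * bernoulli_pmf (mu s.1) s.2 * X s.1 =
  \sum_i action_prob p [::] i * X i.
Proof.
rewrite -(pair_big xpredT xpredT (fun i b =>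
  action_prob p [::] i * bernoulli_pmf (mu i) b * X i)) /=.
by apply: eq_bigr => i _; rewrite big_bool /bernoulli_pmf /=; ring.
Qed.

Lemma expect_cst mu p T c : expect mu p T (fun=> c) = c.
Proof.
elim: T p => [|T IH] p; first by rewrite expect0.
rewrite expectS; under eq_bigr do rewrite IH.
by rewrite (sum_first_round mu p (fun=> c)) -mulr_suml action_prob_sum1 mul1r.
Qed.

(** Given the past and the pulled arm, the reward has the Bernoulli law of that arm, so each [g s]
    may be averaged over its reward. Induction on the horizon, conditioning on the first round. *)
Lemma expect_wald mu p T (g : 'I_K * bool -> R) :
  expect mu p T (fun h => \sum_(s <- h) g s) =
  expect mu p T (fun h => \sum_(s <- h)
    \sum_b bernoulli_pmf (mu s.1) b * g (s.1, b)).
Proof.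
elim: T p => [|T IH] p; first by rewrite !expect0 !big_nil.
rewrite !expectS.
under eq_bigr => s _.
  rewrite (eq_expect (Y := fun h => g s + \sum_(s <- h) g s)); last first.
    by move=> h _; rewrite big_cons.
  rewrite expectD expect_cst IH mulrDr; over.
under [RHS]eq_bigr => s _.
  rewrite (eq_expect (Y := fun h =>
    \sum_b bernoulli_pmf (mu s.1) b * g (s.1, b) +
    \sum_(s <- h) \sum_b bernoulli_pmf (mu s.1) b * g (s.1, b))); last first.
    by move=> h _; rewrite big_cons.
  rewrite expectD expect_cst mulrDr; over.
(* The later rounds agree by induction; only the first-round terms remain. *)
rewrite !big_split /=; congr (_ + _).
rewrite (sum_first_round mu p (fun i => \sum_b bernoulli_pmf (mu i) b * g (i, b))).
under eq_bigr => s _ do rewrite [s in g s]surjective_pairing.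
rewrite -(pair_big xpredT xpredT (fun i b =>
  action_prob p [::] i * bernoulli_pmf (mu i) b * g (i, b))) /=.
by apply: eq_bigr => i _; rewrite mulr_sumr; apply: eq_bigr => b _; rewrite mulrA.
Qed.

Lemma sum_arms (h : history K) (g : 'I_K -> R) :
  \sum_(s <- h) g s.1 = \sum_i g i * (pulls i h)%:R.
Proof.
elim: h => [|s h IH].
  by rewrite big_nil big1 // => i _; rewrite mulr0.
rewrite big_cons IH (bigD1 s.1) //= [RHS](bigD1 s.1) //= eqxx natrD mulrDr.
rewrite mulr1 addrA; congr (_ + _); apply: eq_bigr => i /negPf.
by rewrite eq_sym => ->.
Qed.

Lemma sum_pulls (h : history K) :
  \sum_i (pulls i h)%:R = (size h)%:R :> R.
Proof.
have := sum_arms h (fun=> 1); under [RHS]eq_bigr do rewrite mul1r.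
by move=> <-; rewrite big_const_seq count_predT iter_addr_0.
Qed.

(** * Change of measure between two instances *)

Definition in01 mu := forall i, 0 < mu i < 1.

Lemma bernoulli_pmf_gt0 (q : R) b : 0 < q < 1 -> 0 < bernoulli_pmf q b.
Proof. by case/andP=> ? ?; case: b; rewrite /bernoulli_pmf ?subr_gt0. Qed.

Lemma traj_prob_ge0 mu p T (h : T.-tuple ('I_K * bool)) :
  in01 mu -> 0 <= traj_prob mu p h.
Proof.
move=> mu01; apply: prodr_ge0 => t _; apply: mulr_ge0.
  exact: action_prob_ge0.
exact/ltW/bernoulli_pmf_gt0.
Qed.

Lemma le_expect mu p T X Y : in01 mu ->
  (forall h : T.-tuple ('I_K * bool), X h <= Y h) ->
  expect mu p T X <= expect mu p T Y.
Proof.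
by move=> mu01 XY; apply: ler_sum => h _; rewrite ler_wpM2l // traj_prob_ge0.
Qed.

Lemma expect_ge0 mu p T X : in01 mu ->
  (forall h : T.-tuple ('I_K * bool), 0 <= X h) ->
  0 <= expect mu p T X.
Proof.
by move=> mu01 X0; apply: sumr_ge0 => h _; rewrite mulr_ge0 // traj_prob_ge0.
Qed.

Definition log_ratio mu mu' s : R :=
  ln (bernoulli_pmf (mu s.1) s.2 / bernoulli_pmf (mu' s.1) s.2).

(** The policy is the same under both instances, so the action probabilities are common factors and
    only the reward likelihoods differ. *)
Lemma traj_prob_change mu mu' p T (h : T.-tuple ('I_K * bool)) :
  in01 mu -> in01 mu' ->
  traj_prob mu' p h =
  traj_prob mu p h * expR (- \sum_(s <- h) log_ratio mu mu' s).
Proof.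
move=> mu01 mu'01; rewrite big_tuple -sumrN expR_sum -big_split /=.
apply: eq_bigr => t _; rewrite /log_ratio expRN lnK; last first.
  by rewrite posrE divr_gt0 // bernoulli_pmf_gt0.
rewrite invf_div -[RHS]mulrA; congr (_ * _).
by rewrite mulrCA mulfV ?mulr1 // lt0r_neq0 // bernoulli_pmf_gt0.
Qed.

(* The right-hand side is the Kullback-Leibler divergence of the two laws of the
   trajectory; this is a weak form of the Donsker-Varadhan inequality, obtained
   from 1 + x <= exp x. *)
Lemma expect_log_ratio_ge mu mu' p T (f : history K -> R) :
  in01 mu -> in01 mu' ->
  1 + expect mu p T f - expect mu' p T (fun h => expR (f h)) <=
  expect mu p T (fun h => \sum_(s <- h) log_ratio mu mu' s).
Proof.
move=> mu01 mu'01.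
rewrite -[X in X + _ - _](expect_cst mu p T) -expectD.
have -> : expect mu' p T (fun h => expR (f h)) = expect mu p T
    (fun h => expR (f h - \sum_(s <- h) log_ratio mu mu' s)).
  apply: eq_bigr => h _.
  by rewrite (traj_prob_change p h mu01 mu'01) expRD mulrAC mulrA.
rewrite lerBlDr -expectD; apply: le_expect => // h.
have := expR_ge1Dx (f h - \sum_(s <- h) log_ratio mu mu' s); lra.
Qed.

Lemma log_ratio_mean mu mu' i :
  \sum_b bernoulli_pmf (mu i) b * log_ratio mu mu' (i, b) = kl (mu i) (mu' i).
Proof. by rewrite big_bool. Qed.

Lemma expect_affine mu p T a b X :
  expect mu p T (fun h => a + b * X h) = a + b * expect mu p T X.
Proof. by rewrite expectD expect_cst expectZ. Qed.

End trajectories.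

Lemma klpp (R : realType) (q : R) : 0 < q < 1 -> kl q q = 0.
Proof.
move=> /andP[q0 q1]; rewrite /kl !divff ?ln1 ?mulr0 ?addr0 //.
  by rewrite subr_eq0 gt_eqF.
by rewrite gt_eqF.
Qed.

(** * Fair regret on the template family, and raising the mean of one arm *)

Section template_family.
Context {R : realType} {K : nat} (hK : (1 < K)%N).
Implicit Types (mu : 'I_K -> R) (p : policy R K) (m r : nat).

Lemma le_mu_star mu i : mu i <= mu_star hK mu.
Proof. exact: le_bigmax. Qed.

Lemma gap_ge0 mu i : 0 <= gap hK mu i.
Proof. by rewrite subr_ge0 le_mu_star. Qed.

Lemma mu_star_lt1 mu : is_instance hK mu -> mu_star hK mu < 1.
Proof.
by case=> mu01 _; apply: bigmax_lt => [|i _]; have /andP[] := mu01 (arm1 hK);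
  last by have /andP[] := mu01 i.
Qed.

(** The floor of arm 1 in block one equals the length of the block, so no round of it is left for
    another arm. *)
Lemma mandatory_arm1 mu p m r (h : (m + r).-tuple ('I_K * bool)) :
  blockwise_fair hK p m r -> is_instance hK mu -> traj_prob mu p h != 0 ->
  all (fun s => s.1 == arm1 hK) (take m h).
Proof.
move=> fair hmu h0; have [mu01 _] := hmu.
have hpos : 0 < traj_prob mu p h by rewrite lt_def h0 traj_prob_ge0.
have /= /andP[/forallP/(_ (arm1 hK))] := fair _ hmu _ hpos.
rewrite eqxx all_count eqn_leq count_size => le_m _.
by apply: leq_trans le_m; rewrite size_take_min geq_minl.
Qed.

Lemma size_residual m r (h : (m + r).-tuple ('I_K * bool)) :
  size (drop m h) = r.
Proof. by rewrite size_drop size_tuple addKn. Qed.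

Lemma pulls_residual mu p m r (h : (m + r).-tuple ('I_K * bool)) i :
  blockwise_fair hK p m r -> is_instance hK mu -> traj_prob mu p h != 0 ->
  i != arm1 hK -> pulls i h = pulls i (drop m h).
Proof.
move=> fair hmu h0 i1.
rewrite -{1}(cat_take_drop m h) /pulls count_cat.
rewrite (@eq_in_count _ _ pred0) ?count_pred0 // => s.
move/(allP (mandatory_arm1 fair hmu h0)) => /eqP->.
by rewrite eq_sym (negPf i1).
Qed.

Lemma sum_expected_residual_pulls mu p m r :
  \sum_i expected_residual_pulls mu p m r i = r%:R.
Proof.
rewrite -expect_sum -[RHS](expect_cst mu p (m + r)).
by apply: eq_expect => h _; rewrite sum_pulls size_residual.
Qed.

Lemma expected_residual_pulls_ge0 mu p m r i :
  is_instance hK mu -> 0 <= expected_residual_pulls mu p m r i.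
Proof. by case=> mu01 _; apply: expect_ge0. Qed.

(** Block one earns exactly [m%:R * mu (arm1 hK)], which is what the benchmark grants it after
    subtracting the mandatory gap; only residual losses survive. *)
Lemma fair_regretE mu p m r :
  blockwise_fair hK p m r -> is_instance hK mu ->
  fair_regret hK mu p m r =
  \sum_i gap hK mu i * expected_residual_pulls mu p m r i.
Proof.
move=> fair hmu.
under [RHS]eq_bigr do rewrite -expectZ.
rewrite -expect_sum /fair_regret -[- expect _ _ _ _]mulN1r -expect_affine.
apply: eq_expect => h h0.
rewrite -sum_arms -{1}(cat_take_drop m h) big_cat /=.
have -> : \sum_(s <- take m h) mu s.1 = m%:R * mu (arm1 hK).
  rewrite -[m in RHS](_ : size (take m h) = m); last first.
    by rewrite size_takel // size_tuple leq_addr.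
  rewrite mulr_natl -[RHS]addr0 -iter_addr -[in RHS]count_predT.
  rewrite -big_const_seq !big_seq.
  by apply: eq_bigr => s /(allP (mandatory_arm1 fair hmu h0)) /eqP->.
have -> : \sum_(s <- drop m h) gap hK mu s.1 =
    r%:R * mu_star hK mu - \sum_(s <- drop m h) mu s.1.
  rewrite big_split sumrN /= big_const_seq count_predT size_residual.
  by rewrite iter_addr_0 mulr_natl.
by rewrite /gap natrD; ring.
Qed.

Definition set_mean mu i (l : R) : 'I_K -> R :=
  fun j => if j == i then l else mu j.

(** The family pins the mean of arm 1 only, so any other arm can be moved freely within (0, 1). *)
Lemma set_mean_instance mu i l :
  is_instance hK mu -> i != arm1 hK -> 0 < l < 1 ->
  is_instance hK (set_mean mu i l).
Proof.
move=> [mu01 mu1] i1 l01; split=> [j|]; rewrite /set_mean.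
  by case: ifP.
by rewrite eq_sym (negPf i1).
Qed.

(* Apply [expect_log_ratio_ge] to f = c (1 - N_i^res / r), bounding exp f by its
   chord. By Wald's identity the divergence only sees the pulls of arm i, which
   are all residual since block one is spent on arm 1. *)
Lemma residual_pulls_change mu p m r i l c :
  blockwise_fair hK p m r -> is_instance hK mu -> i != arm1 hK ->
  0 < l < 1 -> (0 < r)%N ->
  c * (1 - expected_residual_pulls mu p m r i / r%:R) -
  (expR c - 1) *
    (1 - expected_residual_pulls (set_mean mu i l) p m r i / r%:R) <=
  kl (mu i) l * expected_residual_pulls mu p m r i.
Proof.
move=> fair hmu i1 l01 r0; have [mu01 _] := hmu.
have [mu'01 _] := set_mean_instance hmu i1 l01.
set mu' := set_mean mu i l.
have rpos : 0 < r%:R :> R by rewrite ltr0n.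
have frac01 (h : (m + r).-tuple ('I_K * bool)) :
    0 <= (1 - (pulls i (drop m h))%:R / r%:R : R) <= 1.
  rewrite subr_ge0 ler_pdivrMr // mul1r ler_nat gerBl divr_ge0 // andbT.
  by rewrite -[leqRHS](size_residual h) count_size.
have := expect_log_ratio_ge p (m + r)
  (fun h => c * (1 - (pulls i (drop m h))%:R / r%:R)) mu01 mu'01.
have -> : expect mu p (m + r)
    (fun h => \sum_(s <- h) log_ratio mu mu' s) =
    kl (mu i) l * expected_residual_pulls mu p m r i.
  rewrite expect_wald -expectZ; apply: eq_expect => h h0.
  under eq_bigr => s _ do rewrite log_ratio_mean.
  rewrite (sum_arms h (fun j => kl (mu j) (mu' j))) (bigD1 i) //=.
  rewrite big1 => [|j ji]; last by rewrite /mu' /set_mean (negPf ji) klpp ?mul0r.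
  by rewrite addr0 /mu' /set_mean eqxx (pulls_residual fair hmu h0).
apply: le_trans.
have frac_mean nu : expect nu p (m + r)
    (fun h => 1 - (pulls i (drop m h))%:R / r%:R) =
    1 - expected_residual_pulls nu p m r i / r%:R.
  rewrite (eq_expect (Y := fun h => 1 + - r%:R^-1 * (pulls i (drop m h))%:R)).
    by rewrite expect_affine mulNr [_^-1 * _]mulrC.
  by move=> h _; rewrite mulNr [_^-1 * _]mulrC.
rewrite expectZ !frac_mean.
suff : expect mu' p (m + r)
    (fun h => expR (c * (1 - (pulls i (drop m h))%:R / r%:R))) <=
    1 + (expR c - 1) * (1 - expected_residual_pulls mu' p m r i / r%:R) by lra.
rewrite -frac_mean -expect_affine; apply: le_expect => // h.
by rewrite [(expR c - 1) * _]mulrC; exact: expR_chord.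
Qed.

End template_family.

(** * Positivity and continuity of [kl], and a criterion for lower limits *)

Lemma ln_gt_subV (R : realType) (x : R) : 0 < x -> x != 1 -> 1 - x^-1 < ln x.
Proof.
move=> x0 x1; have : - ln x != 0 by rewrite oppr_eq0 ln_eq0.
by move/expR_gt1Dx; rewrite expRN lnK ?posrE // => lnx; lra.
Qed.

(** Each of the two terms satisfies [x - y < x * ln (x / y)], and the lower bounds [p - q] and
    [(1 - p) - (1 - q)] add up to 0. *)
Lemma kl_gt0 (R : realType) (p q : R) :
  0 < p < 1 -> 0 < q < 1 -> p != q -> 0 < kl p q.
Proof.
move=> /andP[p0 p1] /andP[q0 q1] pq.
have np0 : 0 < 1 - p by rewrite subr_gt0.
have nq0 : 0 < 1 - q by rewrite subr_gt0.
have term (x y : R) : 0 < x -> 0 < y -> x != y -> x - y < x * ln (x / y).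
  move=> x0 y0 xy.
  have xy1 : x / y != 1.
    by apply: contra xy => /eqP xy1; rewrite -(mulfVK (lt0r_neq0 y0) x) xy1 mul1r.
  have := ln_gt_subV (divr_gt0 x0 y0) xy1.
  rewrite -(ltr_pM2l x0) invf_div mulrBr mulr1 mulrCA mulfV ?mulr1 //.
  exact: lt0r_neq0.
have np_nq : 1 - p != 1 - q by rewrite (inj_eq (addrI 1)) eqr_opp.
have := term _ _ p0 q0 pq; have := term _ _ np0 nq0 np_nq.
rewrite /kl; lra.
Qed.

Lemma kl_continuous (R : realType) (p q : R) :
  0 < p < 1 -> 0 < q < 1 -> {for q, continuous (kl p)}.
Proof.
move=> /andP[p0 p1] /andP[q0 q1].
have np0 : 0 < 1 - p by rewrite subr_gt0.
have nq0 : 0 < 1 - q by rewrite subr_gt0.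
apply: cvgD; apply: cvgM; try exact: cvg_cst.
- apply: continuous_cvg; first exact/continuous_ln/divr_gt0.
  by apply: cvgM; [exact: cvg_cst|apply: cvgV; rewrite ?lt0r_neq0].
- apply: continuous_cvg; first exact/continuous_ln/divr_gt0.
  apply: cvgM; [exact: cvg_cst|apply: cvgV; first by rewrite lt0r_neq0].
  by apply: cvgB; [exact: cvg_cst|exact: cvg_id].
Qed.

(** Replaces a lower limit in the extended reals by eventual real inequalities; the strict [c < x]
    supplies the slack for all later choices of constants. *)
Lemma limn_einf_ge (R : realType) (u : nat -> R) (x : R) :
  (forall c, c < x -> \forall n \near \oo%classic, c <= u n) ->
  (x%:E <= limn_einf (fun n => (u n)%:E))%E.
Proof.
move=> ux; apply/lee_addgt0Pr => e e0.
have /ux[N _ uN] : x - e < x by rewrite gtrBl.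
rewrite -leeBlDr // limn_einf_lim; apply: lime_ge; first exact: is_cvg_einfs.
exists N => // k /= Nk; apply: le_ereal_inf_tmp => _ [n /= kn <-].
by rewrite lee_fin uN //= (leq_trans Nk).
Qed.

(** * Consequences of uniform fastness for large residual budgets *)

Section asymptotics.
Context {R : realType} {K : nat} (hK : (1 < K)%N).
Variables (M : nat -> nat) (pol : nat -> policy R K).
Hypothesis hfair : forall r, blockwise_fair hK (pol r) (M r) r.
Hypothesis hfast : uniformly_fast hK M pol.

Local Notation N mu r i := (expected_residual_pulls mu (pol r) (M r) r i).

Lemma fair_regret_small mu a e :
  is_instance hK mu -> 0 < a <= 1 -> 0 < e ->
  \forall r \near \oo%classic,
    fair_regret hK mu (pol r) (M r) r <= e * r%:R `^ a.
Proof.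
move=> hmu a01 e0.
have /eqoP/(_ e e0) := hfast hmu a01.
apply: filterS => r; rewrite [X in _ * X]ger0_norm ?powR_ge0 //.
exact/le_trans/ler_norm.
Qed.

Lemma gap_pulls_le_regret mu r i : is_instance hK mu ->
  gap hK mu i * N mu r i <= fair_regret hK mu (pol r) (M r) r.
Proof.
move=> hmu; rewrite fair_regretE // (bigD1 i) //= lerDl sumr_ge0 // => j _.
by apply: mulr_ge0; [exact: gap_ge0|exact: expected_residual_pulls_ge0 hmu].
Qed.

(** After the change, every arm other than [i] keeps a mean at most [mu_star hK mu], while the best
    mean is at least [l]; so each residual round not given to [i] costs at least the difference. *)
Lemma missed_pulls_le_regret mu r i l :
  is_instance hK mu -> i != arm1 hK -> 0 < l < 1 ->
  (l - mu_star hK mu) * (r%:R - N (set_mean mu i l) r i) <=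
  fair_regret hK (set_mean mu i l) (pol r) (M r) r.
Proof.
move=> hmu i1 l01; have hmu' := set_mean_instance hmu i1 l01.
rewrite fair_regretE //.
rewrite -(sum_expected_residual_pulls (set_mean mu i l) (pol r) (M r)).
rewrite [X in _ * (X - _)](bigD1 i) //= [X in _ * (X - _)]addrC addrK.
rewrite mulr_sumr [leRHS](bigD1 i) //= -[leLHS]add0r.
apply: lerD.
  by apply: mulr_ge0; [exact: gap_ge0|exact: expected_residual_pulls_ge0 hmu'].
apply: ler_sum => j ji; apply: ler_wpM2r.
  exact: expected_residual_pulls_ge0 hmu'.
have := le_mu_star hK (set_mean mu i l) i; have := le_mu_star hK mu j.
by rewrite /gap /set_mean eqxx (negPf ji); lra.
Qed.

Lemma residual_pulls_eventually mu i c :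
  is_instance hK mu -> i != arm1 hK -> 0 < gap hK mu i ->
  c < 1 / kl (mu i) (mu_star hK mu) ->
  \forall r \near \oo%classic, c <= N mu r i / ln r%:R.
Proof.
move=> hmu i1 gapi; have [mu01 _] := hmu.
have q1 := mu_star_lt1 hmu.
have q0 : 0 < mu_star hK mu.
  by apply: lt_le_trans (le_mu_star hK mu i); have /andP[] := mu01 i.
have iq : mu i < mu_star hK mu by rewrite -subr_gt0.
rewrite ltr_pdivlMr; last by rewrite kl_gt0 ?q0 // lt_eqF.
move=> ckl.
(* Continuity of [kl] in its second argument leaves room to raise arm [i] strictly above the old
   optimum while keeping the strict bound on [c]. *)
have [l /andP[ql l1] ckl'] :
    exists2 l, mu_star hK mu < l < 1 & c * kl (mu i) l < 1.
  have ckl_cvg : (c * kl (mu i) l @[l --> mu_star hK mu] -->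
      c * kl (mu i) (mu_star hK mu))%classic.
    by apply: cvgM; [exact: cvg_cst|apply: kl_continuous; rewrite ?q0].
  have ckl_near := cvgr_lt _ ckl_cvg _ ckl.
  near ((mu_star hK mu)^'+)%classic => l.
  exists l.
    apply/andP; split; near: l; first exact: nbhs_right_gt.
    exact: nbhs_right_lt.
  by near: l; apply: cvg_within; exact: ckl_near.
have l01 : 0 < l < 1 by rewrite l1 (lt_trans q0).
have kl0 : 0 < kl (mu i) l by rewrite kl_gt0 // lt_eqF // (lt_trans iq).
(* The final estimate loses three times [a * L]: two from the square of [1 - a], one from an
   additive 1 absorbed by [aL]. *)
pose a := Num.min 1 ((1 - c * kl (mu i) l) / 3).
have a0 : 0 < a by rewrite /a lt_min ltr01 divr_gt0 ?subr_gt0.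
have a1 : a <= 1 by rewrite ge_min lexx.
have a3 : 3 * a <= 1 - c * kl (mu i) l.
  by rewrite mulrC -ler_pdivlMr // ge_min lexx orbT.
have d0 : 0 < l - mu_star hK mu by rewrite subr_gt0.
pose N' r := N (set_mean mu i l) r i.
near=> r.
have r1 : 1 < r%:R :> R.
  by rewrite ltr1n; near: r; exact: nbhs_infty_gt.
have r0 : 0 < r%:R :> R by rewrite (lt_trans ltr01).
pose L : R := ln r%:R.
have L0 : 0 < L by rewrite ln_gt0.
have aL : 1 <= a * L.
  rewrite mulrC -ler_pdivrMr // -[leLHS]expRK ler_ln ?posrE ?expR_gt0 //.
  by near: r; exact: nbhs_infty_ger.
(* Uniform fastness with exponent 1 under [mu]; the constant [gap hK mu i * a] is chosen so that the
   gap cancels. *)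
have Nr : N mu r i <= a * r%:R.
  rewrite -(ler_pM2l gapi); apply: le_trans (gap_pulls_le_regret r i hmu) _.
  rewrite mulrA -[X in _ <= _ * X](powRr1 (ltW r0)); near: r.
  by apply: fair_regret_small; rewrite ?ltr01 ?lexx ?mulr_gt0.
(* Uniform fastness with exponent [a] under the raised instance, with constant
   [l - mu_star hK mu]. *)
have N'r : r%:R - N' r <= r%:R `^ a.
  rewrite -(ler_pM2l d0); apply: le_trans (missed_pulls_le_regret r hmu i1 l01) _.
  near: r; apply: fair_regret_small; rewrite ?a0 //.
  exact: set_mean_instance.
have N'0 : 0 <= 1 - N' r / r%:R.
  rewrite subr_ge0 ler_pdivrMr // mul1r.
  rewrite -[leRHS](sum_expected_residual_pulls (set_mean mu i l) (pol r) (M r)).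
  rewrite (bigD1 i) //= lerDl sumr_ge0 // => j _.
  exact: expected_residual_pulls_ge0 (set_mean_instance hmu i1 l01).
(* This dictates the tilt [(1 - a) * L]: its exponential is r to the power [1 - a], exactly offset
   by the missed fraction, at most r to the power [a - 1]. *)
have missed : (expR ((1 - a) * L) - 1) * (1 - N' r / r%:R) <= 1.
  apply: (@le_trans _ _ (expR ((1 - a) * L) * (1 - N' r / r%:R))).
    by rewrite ler_wpM2r // gerBl.
  apply: (@le_trans _ _ (expR ((1 - a) * L) * (r%:R `^ a / r%:R))).
    rewrite ler_wpM2l ?expR_ge0 // ler_pdivlMr // mulrBl mul1r mulfVK //.
    exact: lt0r_neq0.
  have -> : r%:R `^ a = expR (a * L) by rewrite /powR gt_eqF.
  have -> : r%:R = expR L :> R by rewrite lnK.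
  by rewrite -expRN -!expRD (_ : _ + _ = 0) ?expR0 //; ring.
have r_gt0 : (0 < r)%N by rewrite -(ltr_nat R).
have kl_ge := residual_pulls_change ((1 - a) * L) (@hfair r) hmu i1 l01 r_gt0.
rewrite -/L ler_pdivlMr // -(ler_pM2l kl0).
apply: le_trans kl_ge.
have Nr' : 1 - a <= 1 - N mu r i / r%:R.
  by rewrite lerB // ler_pdivrMr.
(* What remains is that the square of [1 - a], times [L], minus 1 is at least [(1 - 3 * a) * L],
   hence at least [c * kl (mu i) l * L]. *)
have : (1 - a) * L * (1 - a) <= (1 - a) * L * (1 - N mu r i / r%:R).
  by rewrite ler_wpM2l // mulr_ge0 ?subr_ge0 // ltW.
have : 3 * a * L <= (1 - c * kl (mu i) l) * L by rewrite ler_wpM2r // ltW.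
have : 0 <= a * a * L by rewrite !mulr_ge0 // ltW.
rewrite -/(N' r); lra.
Unshelve. all: by end_near. Qed.

End asymptotics.

(** * Lower limits for the pulls of each arm and for the regret *)

Theorem theorem19 (R : realType) (K : nat) (hK : (1 < K)%N)
    (M : nat -> nat) (hM : poly_growth M)
    (pol : nat -> policy R K)
    (hfair : forall r, blockwise_fair hK (pol r) (M r) r)
    (hfast : uniformly_fast hK M pol)
    (mu : 'I_K -> R) (hmu : is_instance hK mu) :
  (forall i : 'I_K, i != arm1 hK -> 0 < gap hK mu i ->
    ((1 / kl (mu i) (mu_star hK mu))%:E <=
     limn_einf (fun r : nat =>
       (expected_residual_pulls mu (pol r) (M r) r i / ln r%:R)%:E))%E) /\
  ((\sum_(i < K | (i != arm1 hK) && (0 < gap hK mu i))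
      gap hK mu i / kl (mu i) (mu_star hK mu))%:E <=
   limn_einf (fun r : nat =>
     (fair_regret hK mu (pol r) (M r) r / ln r%:R)%:E))%E.
Proof.
split=> [i i1 gapi|].
  by apply: limn_einf_ge => c; exact: residual_pulls_eventually.
apply: limn_einf_ge => c c_lt.
pose P (i : 'I_K) := (i != arm1 hK) && (0 < gap hK mu i).
pose S := \sum_(i | P i) gap hK mu i / kl (mu i) (mu_star hK mu).
(* The 1 keeps G positive when no arm satisfies P. *)
pose G := 1 + \sum_(i | P i) gap hK mu i.
have G0 : 0 < G.
  by rewrite ltr_wpDr // sumr_ge0 // => i /andP[_ /ltW].
(* The slack [S - c] is shared among the arms: lowering each pull bound by [e] costs [e] times the
   sum of the gaps, at most [e * G = S - c]. *)
pose e := (S - c) / G.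
have e0 : 0 < e by rewrite divr_gt0 // subr_gt0.
(* There are finitely many arms, so one threshold on [r] serves them all. *)
have pulls_near : \forall r \near \oo%classic, forall i, P i ->
    1 / kl (mu i) (mu_star hK mu) - e <=
    expected_residual_pulls mu (pol r) (M r) r i / ln r%:R.
  apply: filter_forall => i; have [/andP[i1 gapi]|_] := boolP (P i).
    have lt_e : 1 / kl (mu i) (mu_star hK mu) - e < 1 / kl (mu i) (mu_star hK mu).
      by rewrite gtrBl.
    by apply: filterS (residual_pulls_eventually hfair hfast hmu i1 gapi lt_e).
  by apply: nearW.
near=> r.
have L0 : 0 <= ln r%:R :> R.
  by rewrite ln_ge0 // ler1n; near: r; exact: nbhs_infty_ge.
apply: (@le_trans _ _ (S - e * G)); first by rewrite /e mulfVK ?lt0r_neq0 //; lra.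
apply: (@le_trans _ _ (S - e * \sum_(i | P i) gap hK mu i)).
  by rewrite lerB // ler_pM2l // lerDr.
rewrite fair_regretE // mulr_suml mulr_sumr -sumrB.
apply: (@le_trans _ _ (\sum_(i | P i) gap hK mu i *
    expected_residual_pulls mu (pol r) (M r) r i / ln r%:R)).
  apply: ler_sum => i Pi; have /andP[_ /ltW gapi] := Pi.
  rewrite [e * _]mulrC -mulrBr -mulrA ler_wpM2l // -[_^-1]mul1r.
  by move: i Pi {gapi}; near: r.
(* Arms outside [P] contribute nonnegative regret and are dropped. *)
rewrite [leRHS](bigID P) /= lerDl sumr_ge0 // => i _.
apply: divr_ge0 => //.
by apply: mulr_ge0; [exact: gap_ge0|exact: expected_residual_pulls_ge0 hmu].
Unshelve. all: by end_near. Qed.
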